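(* Let $L\subset V$ be a connected linear subspace containing the constant function $1$, let $\mathcal{H}$ be the set of maximal extended compact components of $L$, regarded as a hypergraph on $[m]$, and let $H_{\mathcal{H}}=\sum_{C\in\mathcal{H}}F_C$. Then $\mathcal{M}(H_{\mathcal{H}})$ is the smallest decomposable model, with respect to the inclusion relation, such that $\mathcal{M}(L)$ is a hierarchical subspace model (HSM) of it; that is, $\mathcal{M}(H_{\mathcal{H}})$ is a decomposable model, $\mathcal{M}(L)$ is an HSM of $H_{\mathcal{H}}$, and $\mathcal{M}(H_{\mathcal{H}})$ is the smallest among all decomposable models $\mathcal{M}(H_\Delta)$ such that $\mathcal{M}(L)$ is an HSM of $H_\Delta$.
   Context: **Tables and log-affine models.** $[J]=\{1,\dots,J\}$. Fix $I_1,\dots,I_m\ge 2$, $\mathcal{I}=[I_1]\times\cdots\times[I_m]$, and let $V$ be the real vector space of functions $\mathcal{I}\to\mathbb{R}$. For $D\subset[m]$, $\boldsymbol{i}_D=(i_j)_{j\in D}$ and $F_D\subset V$ is the subspace of functions depending only on $\boldsymbol{i}_D$. For a linear subspace $L\subset V$ containing the constant $1$, the log-affine model $\mathcal{M}(L)$ is the set of probability functions $p$ on $\mathcal{I}$ with $\log p\in L$. $D$ is saturated in $L$ if $F_D\subset L$. $L$ is conformal to subspaces $W_1,\dots,W_K$ if $L=(L\cap W_1)+\cdots+(L\cap W_K)$. **Notions for $L$.** $L$ is connected if there is no non-empty proper subset $A\subset[m]$ such that $L$ is conformal to $\{F_A,F_{[m]\setminus A}\}$. A non-empty $S\subset[m]$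 is an $L$-separator if $[m]$ is partitioned into non-empty disjoint subsets $A_1,A_2,S$ such that $S$ is saturated in $L$ and $L$ is conformal to $\{F_{A_1\cup S},F_{A_2\cup S}\}$; then $(A_1,A_2,S)$ is called a decomposition of $L$. Vertices $v,v'$ are tightly connected in $L$ if there is no decomposition $(A_1,A_2,S)$ of $L$ with $v\in A_1$, $v'\in A_2$. A set of vertices any two of which are tightly connected in $L$ is an extended compact component of $L$. **Hierarchical models and hypergraphs.** For a simplicial complex $\Delta$ on $[m]$, $\mathrm{red}\,\Delta$ is the set of its facets, regarded as a hypergraph, and $H_\Delta=\sum_{D\in\mathrm{red}\,\Delta}F_D$. $\mathcal{M}(H_\Delta)$ is decomposable if $\mathrm{red}\,\Delta$ is the set of maximal cliques of a chordal graph on $[m]$. ($H_{\mathcal{H}}$ is $H_\Delta$ for the complex with facets $\mathcal{H}$.) Two vertices are adjacent if they lie in a common hyperedge. A partial edge is a subset of a hyperedge. A partial edge $S$ is a (partial edge) separator if the subhypergraph induced by $[m]\setminus S$ is disconnected; then there is a decomposition $\{A,B,S\}$: a partition of $[m]$ with $A,B$ non-empty and no vertex of $A$ adjacent to a vertex of $B$. $S$ separates $u$ and $v$ if there is such a decomposition with $u\in A$, $v\in B$. A partial edge separator $S$ is a divider if there are two vertices separated by $S$ but by no proper subset of $S$. A set of vertices is a compact component if no two of its vertices are separated by a partial edge. $\mathcal{C}$ denotes the set of maximal compact components (for a decomposable model, these are the maximal cliques). **HSM.** $\mathcal{M}(L)$ is a hierarchical subspace model (HSM) of $H_\Delta$ if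 (1) each divider $S$ of $\mathrm{red}\,\Delta$ is saturated in $L$, and (2) $L$ is conformal to $\{F_C: C\in\mathcal{C}\}$. *)

(* Defs.v *)
From HB Require Import structures.
From mathcomp Require Import all_boot all_order all_algebra.
From mathcomp Require Import classical_sets reals exp.
(* [finset] again, so that [set0] etc. denote finite sets. *)
From mathcomp Require Import finset.
Set Implicit Arguments.
Unset Strict Implicit.
Unset Printing Implicit Defensive.
Import Order.TTheory GRing.Theory Num.Theory.
Local Open Scope ring_scope.

(* The vertex set [m] is ['I_m], and the levels of variable [j] are ['I_(I j)]. *)
Definition cell (m : nat) (I : 'I_m -> nat) := {dffun forall j : 'I_m, 'I_(I j)}.

(* [R^o] makes the function space a finite-dimensional vector space over [R]. *)
Definition tspace (R : realType) (m : nat) (I : 'I_m -> nat) :=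
  {ffun cell I -> R^o}.

Definition agree (m : nat) (I : 'I_m -> nat) (D : {set 'I_m}) (x y : cell I) : bool :=
  [forall j in D, x j == y j].

Definition evalB (R : realType) (m : nat) (I : 'I_m -> nat) (x y : cell I)
  (f : tspace R I) : R^o := f x - f y.

(* The functions depending only on the coordinates in [D], as an intersection of
   kernels; [mem_Fsp] gives the usual description. *)
Definition Fsp (R : realType) (m : nat) (I : 'I_m -> nat) (D : {set 'I_m}) :
    {vspace tspace R I} :=
  (\bigcap_(xy : cell I * cell I | agree D xy.1 xy.2)
     lker (linfun (@evalB R m I xy.1 xy.2)))%VS.

Lemma evalB_is_linear (R : realType) (m : nat) (I : 'I_m -> nat) (x y : cell I) :
  linear (@evalB R m I x y).
Proof.
move=> a f g; rewrite /evalB !ffunE /= scalerBr opprD !addrA; congr (_ + _).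
by rewrite -!addrA; congr (_ + _); rewrite addrC.
Qed.

HB.instance Definition _ (R : realType) (m : nat) (I : 'I_m -> nat) (x y : cell I) :=
  GRing.isLinear.Build R (tspace R I) R^o *:%R (@evalB R m I x y)
    (evalB_is_linear x y).

Lemma mem_Fsp (R : realType) (m : nat) (I : 'I_m -> nat) (D : {set 'I_m})
    (f : tspace R I) :
  reflect (forall x y : cell I, (forall j, j \in D -> x j = y j) -> f x = f y)
          (f \in Fsp R I D).
Proof.
apply: (iffP idP) => [fD x y xy | fD].
  have /subvP/(_ f fD) : (Fsp R I D <= lker (linfun (@evalB R m I x y)))%VS.
    apply: (@bigcapv_inf _ _ _ (x, y)) => //=.
    by apply/forall_inP => j jD; rewrite xy.
  by rewrite memv_ker lfunE /= => /eqP/subr0_eq.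
rewrite memvE; apply/subv_bigcapP => -[x y] /= /forall_inP xy.
rewrite -memvE memv_ker lfunE /= /evalB (fD x y) ?subrr // => j jD.
exact/eqP/xy.
Qed.

Definition saturated (R : realType) (m : nat) (I : 'I_m -> nat)
  (L : {vspace tspace R I}) (D : {set 'I_m}) : bool := (Fsp R I D <= L)%VS.

Definition conformal (R : realType) (m : nat) (I : 'I_m -> nat)
    (L : {vspace tspace R I}) (Ws : seq {vspace tspace R I}) : bool :=
  L == (\sum_(W <- Ws) (L :&: W))%VS.

(* Strict positivity makes [log p] meaningful ([ln] is a total function). *)
Definition logaffine (R : realType) (m : nat) (I : 'I_m -> nat)
    (L : {vspace tspace R I}) : set (tspace R I) :=
  [set p : tspace R I | [/\ forall i, 0 < (p i : R), \sum_i (p i : R) = 1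
     & [ffun i => ln (p i : R) : R^o] \in L]]%classic.

Definition connected_sp (R : realType) (m : nat) (I : 'I_m -> nat)
    (L : {vspace tspace R I}) : Prop :=
  ~ exists A : {set 'I_m},
      [/\ A != set0, A \proper [set: 'I_m]
        & conformal L [:: Fsp R I A; Fsp R I (~: A)]].

Definition tripartition (m : nat) (A B S : {set 'I_m}) : bool :=
  [&& A :|: B :|: S == [set: 'I_m], [disjoint A & B], [disjoint A & S]
    & [disjoint B & S]].

Definition sp_decomposition (R : realType) (m : nat) (I : 'I_m -> nat)
    (L : {vspace tspace R I}) (A1 A2 S : {set 'I_m}) : bool :=
  [&& tripartition A1 A2 S, A1 != set0, A2 != set0, S != set0, saturated L S
    & conformal L [:: Fsp R I (A1 :|: S); Fsp R I (A2 :|: S)]].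

Definition tight (R : realType) (m : nat) (I : 'I_m -> nat)
    (L : {vspace tspace R I}) (u v : 'I_m) : bool :=
  ~~ [exists A1 : {set 'I_m}, exists A2 : {set 'I_m}, exists S : {set 'I_m},
        [&& sp_decomposition L A1 A2 S, u \in A1 & v \in A2]].

Definition ext_compact (R : realType) (m : nat) (I : 'I_m -> nat)
    (L : {vspace tspace R I}) (C : {set 'I_m}) : bool :=
  [forall u in C, forall v in C, tight L u v].

Definition max_ext_compact (R : realType) (m : nat) (I : 'I_m -> nat)
    (L : {vspace tspace R I}) : {set {set 'I_m}} :=
  [set C | maxset (ext_compact L) C].

Definition simplicial_complex (m : nat) (Delta : {set {set 'I_m}}) : Prop :=
  forall D E : {set 'I_m}, D \in Delta -> E \subset D -> E \in Delta.

Definition red (m : nat) (Delta : {set {set 'I_m}}) : {set {set 'I_m}} :=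
  [set D | maxset (fun E => E \in Delta) D].

Definition complex_of (m : nat) (H : {set {set 'I_m}}) : {set {set 'I_m}} :=
  [set D : {set 'I_m} | [exists E in H, D \subset E]].

Definition hsp (R : realType) (m : nat) (I : 'I_m -> nat) (H : {set {set 'I_m}}) :
    {vspace tspace R I} :=
  (\sum_(D in H) Fsp R I D)%VS.

Definition adjacent (m : nat) (H : {set {set 'I_m}}) (u v : 'I_m) : bool :=
  [exists E in H, (u \in E) && (v \in E)].

Definition partial_edge (m : nat) (H : {set {set 'I_m}}) (S : {set 'I_m}) : bool :=
  [exists E in H, S \subset E].

Definition induced (m : nat) (H : {set {set 'I_m}}) (U : {set 'I_m}) :
    {set {set 'I_m}} :=
  [set E :&: U | E in H].

(* The vertex set of the induced subhypergraph is [U], including the vertices of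
   [U] that lie in no hyperedge. *)
Definition induced_disconnected (m : nat) (H : {set {set 'I_m}})
    (U : {set 'I_m}) : bool :=
  [exists u in U, exists v in U, ~~ connect (adjacent (induced H U)) u v].

(* [S] may be empty: [set0] is a partial edge of every non-empty hypergraph. *)
Definition separator (m : nat) (H : {set {set 'I_m}}) (S : {set 'I_m}) : bool :=
  partial_edge H S && induced_disconnected H (~: S).

Definition hg_decomposition (m : nat) (H : {set {set 'I_m}})
    (A B S : {set 'I_m}) : bool :=
  [&& tripartition A B S, A != set0, B != set0
    & [forall u in A, forall v in B, ~~ adjacent H u v]].

Definition separates (m : nat) (H : {set {set 'I_m}}) (S : {set 'I_m})
    (u v : 'I_m) : bool :=
  separator H S &&
  [exists A : {set 'I_m}, exists B : {set 'I_m},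
     [&& hg_decomposition H A B S, u \in A & v \in B]].

Definition divider (m : nat) (H : {set {set 'I_m}}) (S : {set 'I_m}) : bool :=
  separator H S &&
  [exists u : 'I_m, exists v : 'I_m, separates H S u v &&
     [forall T : {set 'I_m}, (T \proper S) ==> ~~ separates H T u v]].

Definition hg_compact (m : nat) (H : {set {set 'I_m}}) (C : {set 'I_m}) : bool :=
  [forall u in C, forall v in C,
     ~~ [exists S : {set 'I_m}, separates H S u v]].

Definition max_compact (m : nat) (H : {set {set 'I_m}}) : {set {set 'I_m}} :=
  [set C | maxset (hg_compact H) C].

(* A chord joins two vertices that are not consecutive on the cycle. *)
Definition chordal (m : nat) (g : rel 'I_m) : Prop :=
  forall c : seq 'I_m, ucycle g c -> (3 < size c)%N ->
    exists u v : 'I_m,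
      [/\ u \in c, v \in c, v != next c u, u != next c v & g u v].

Definition clique (m : nat) (g : rel 'I_m) (K : {set 'I_m}) : bool :=
  [forall u in K, forall v in K, (u != v) ==> g u v].

Definition max_cliques (m : nat) (g : rel 'I_m) : {set {set 'I_m}} :=
  [set K | maxset (clique g) K].

Definition decomposable (m : nat) (H : {set {set 'I_m}}) : Prop :=
  exists g : rel 'I_m,
    [/\ symmetric g, irreflexive g, chordal g & H = max_cliques g].

(* [logaffine L] is an HSM of [hsp H], where [H = red Delta]. *)
Definition HSM (R : realType) (m : nat) (I : 'I_m -> nat)
    (L : {vspace tspace R I}) (H : {set {set 'I_m}}) : Prop :=
  (forall S : {set 'I_m}, divider H S -> saturated L S) /\
  conformal L [seq Fsp R I C | C <- enum (max_compact H)].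

(* The maximal extended compact components are the facets of a complex. *)
Lemma complex_of_simplicial (m : nat) (H : {set {set 'I_m}}) :
  simplicial_complex (complex_of H).
Proof.
move=> D E; rewrite !inE => /exists_inP[F HF DF] ED.
by apply/exists_inP; exists F => //; exact: (fintype.subset_trans ED DF).
Qed.

Lemma red_complex_of_max_ext_compact (R : realType) (m : nat) (I : 'I_m -> nat)
    (L : {vspace tspace R I}) :
  red (complex_of (max_ext_compact L)) = max_ext_compact L.
Proof.
apply/setP => C; rewrite [LHS]inE; apply/idP/idP => [/maxsetP[HC maxC]|HC].
  move: HC; rewrite inE => /exists_inP[E HE CE].
  by rewrite -(maxC E) // inE; apply/exists_inP; exists E.
apply/maxsetP; split=> [|D].
  by rewrite inE; apply/exists_inP; exists C.
rewrite inE => /exists_inP[E HE DE] CD.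
move: HC HE; rewrite !inE => /maxsetP[_ maxC] /maxsetP[eE _].
have EC : E = C by apply: maxC => //; exact: (fintype.subset_trans CD DE).
by apply/eqP; rewrite eqEsubset CD andbT -EC.
Qed.

(* Main.v *)
(* Fix a base cell and let [restrict C] freeze the coordinates outside [C] at it.
   These are commuting projections onto the spaces [F_C], and a decomposition
   (A1, A2, S) of [L] says that restriction to A1 u S and A2 u S preserves [L] and
   that f = f|(A1 u S) + f|(A2 u S) - f|S on [L].  Splitting along decompositions
   as long as the current vertex set contains a non-tight pair writes [f] as a sum
   of functions in [L] on sets of pairwise tight vertices: [L] is conformal to
   these.  A saturated set is pairwise tight, so non-tight vertices are separated
   in the tightness graph by a clique, whence the graph is chordal.  If S is a
   minimal separator of it, each of the two sides has a vertex adjacent to all of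
   S; the two are not tight, and the separator of any decomposition of [L]
   separating them contains S, so S is saturated.  For minimality, non-adjacent
   vertices of a decomposable model are separated by a divider (Dirac: minimal
   separators of chordal graphs are cliques), which yields a decomposition of [L]
   because [L] is connected; hence the two vertices are not tight. *)

Require Import Defs.
From mathcomp Require Import all_boot all_order all_algebra.
From mathcomp Require Import classical_sets reals exp.
From mathcomp Require Import fintype finset.
Import Order.TTheory GRing.Theory Num.Theory.
Local Open Scope ring_scope.

Set Implicit Arguments.
Unset Strict Implicit.
Unset Printing Implicit Defensive.

(** * Separators in graphs *)

Definition avoiding (T : finType) (e : rel T) (S : {set T}) : rel T :=
  [rel x y | [&& e x y, x \notin S & y \notin S]].

Definition component (T : finType) (e : rel T) (S : {set T}) (u : T) : {set T} :=
  [set x | connect (avoiding e S) u x].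

(** [component e S u] contains [u] even when [u] is in [S], because [connect] is reflexive; hence
    the explicit conditions on the two ends. *)
Definition separated (T : finType) (e : rel T) (S : {set T}) (u v : T) : bool :=
  [&& u \notin S, v \notin S & v \notin component e S u].

(** The pairs x = x are included, so this is the clique notion for graphs with loops such as
    [tight L]; [cliqueP] passes to the loopless [clique]. *)
Definition complete (T : finType) (e : rel T) (S : {set T}) : Prop :=
  {in S &, forall x y, e x y}.

Lemma component_sub (T : finType) (e : rel T) (S A : {set T}) (u : T) :
  u \in A -> (forall x y, x \in A -> avoiding e S x y -> y \in A) ->
  component e S u \subset A.
Proof.
move=> uA step; apply/subsetP => x; rewrite inE => /connectP[p pth ->].
by elim: p u uA pth => //= y p IH u uA /andP[uy]; apply/IH/(step u).
Qed.

Lemma component_notin (T : finType) (e : rel T) (S : {set T}) (u : T) :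
  u \notin S -> component e S u \subset ~: S.
Proof.
move=> uS; apply: component_sub => [|x y _ /and3P[_ _ yS]]; by rewrite inE.
Qed.

Lemma component_step (T : finType) (e : rel T) (S : {set T}) (u x y : T) :
  u \notin S -> x \in component e S u -> e x y -> y \notin S ->
  y \in component e S u.
Proof.
move=> uS xK xy yS; have xS := subsetP (component_notin e uS) x xK.
rewrite inE in xS; rewrite inE in xK; rewrite inE.
have xy' : avoiding e S x y by by exact/and3P.
exact: connect_trans xK (connect1 xy').
Qed.

Lemma avoiding_sym (T : finType) (e : rel T) (S : {set T}) :
  symmetric e -> symmetric (avoiding e S).
Proof. by move=> e_sym x y; rewrite /avoiding /= e_sym; congr (_ && _); rewrite andbC. Qed.

Lemma component_connect (T : finType) (e : rel T) (S : {set T}) (u x y : T) :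
  symmetric e -> x \in component e S u -> y \in component e S u ->
  connect (avoiding e S) x y.
Proof.
move=> e_sym; rewrite !inE => ux; apply: connect_trans.
by rewrite (sym_connect_sym (avoiding_sym S e_sym)).
Qed.

Lemma separated_sym (T : finType) (e : rel T) (S : {set T}) (u v : T) :
  symmetric e -> separated e S u v = separated e S v u.
Proof.
move=> e_sym; rewrite /separated !inE andbCA.
by rewrite (sym_connect_sym (avoiding_sym S e_sym)).
Qed.

Lemma separated_path (T : finType) (e : rel T) (S : {set T}) (u : T) (p : seq T) :
  path e u p -> separated e S u (last u p) -> exists2 z, z \in p & z \in S.
Proof.
move=> pth /and3P[uS _]; case: (boolP (has (mem S) p)) => [/hasP[z]|/hasPn pS].
  by exists z.
case/negP; rewrite inE; apply/connectP; exists p => //.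
elim: p u uS pth pS => //= y p IH u uS /andP[uy pth] pS.
have yS : y \notin S by apply: pS; rewrite mem_head.
by rewrite /avoiding /= uy uS yS IH // => z zp; apply: pS; rewrite inE zp orbT.
Qed.

Lemma separated_components_nonadjacent (T : finType) (e : rel T) (S : {set T})
    (u v x y : T) :
  symmetric e -> separated e S u v ->
  x \in component e S u -> y \in component e S v -> ~~ e x y.
Proof.
move=> e_sym /and3P[uS vS uv] xK yK; apply/negP => xy; case/negP: uv.
have yS : y \notin S by have := subsetP (component_notin e vS) y yK; rewrite inE.
have yKu := component_step uS xK xy yS.
move: yK yKu; rewrite !inE => vy uy; apply: connect_trans uy _.
by rewrite (sym_connect_sym (avoiding_sym S e_sym)).
Qed.

(** If no vertex of the component of [u] were adjacent to [s], removing [s] from [S] would not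
    enlarge that component, and [S :\ s] would still separate. *)
Lemma minimal_separator_neighbor (T : finType) (e : rel T) (S : {set T})
    (u v s : T) :
  separated e S u v ->
  (forall S' : {set T}, S' \proper S -> ~~ separated e S' u v) ->
  s \in S -> exists2 k, k \in component e S u & e k s.
Proof.
move=> /and3P[uS vS uv] minS sS.
apply/exists_inP; apply: contraT => /exists_inPn noN.
have := minS _ (properD1 sS); rewrite /separated !inE (negPf uS) (negPf vS).
rewrite !andbF /= negbK => con.
suff /subsetP/(_ v) : component e (S :\ s) u \subset component e S u.
  by rewrite inE con (negPf uv) => /(_ isT).
apply: component_sub => [|x y xK /and3P[xy _]]; first by rewrite inE.
rewrite !inE negb_and negbK => /orP[/eqP ys|yS].
  by case/negP: (noN x xK); rewrite -ys.
by have := component_step uS xK xy yS; rewrite inE.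
Qed.

(** If [k] misses [s], a complete [Q] separates them and meets the path in some [z]. All neighbours
    of [k] in [S] lie in [Q], so [z] inherits them; the argument continues from [z] on a shorter
    path. *)
Lemma dominating_vertex_on_path (T : finType) (e : rel T) (S : {set T})
    (s k : T) (p : seq T) :
  symmetric e ->
  (forall x y, ~~ e x y -> exists2 Q, complete e Q & separated e Q x y) ->
  complete e S -> s \in S -> path e k p -> e (last k p) s ->
  exists k', [/\ k' \in k :: p, e k' s & forall t, t \in S -> e k t -> e k' t].
Proof.
move=> e_sym sepQ Scl sS.
have [n] := ubnP (size p); elim: n k p => // n IH k p szp pth lst.
have [ks|nks] := boolP (e k s).
  by exists k; split=> //; rewrite mem_head.
have [Q Qcl Qsep] := sepQ _ _ nks.
have sQ : s \notin Q by case/and3P: Qsep.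
have [||z] := @separated_path _ e Q k (rcons p s) _ _.
- by rewrite rcons_path pth.
- by rewrite last_rcons.
rewrite mem_rcons inE => /orP[/eqP->|zp zQ]; first by rewrite (negPf sQ).
(* [Q] must meet the path k, t, s, and only [t] can lie in it. *)
have tz t : t \in S -> e k t -> e z t.
  move=> tS kt; apply: Qcl => //.
  have [|z'] := @separated_path _ e Q k [:: t; s] _ Qsep.
    by rewrite /= kt Scl.
  by rewrite !inE => /orP[] /eqP-> //; rewrite (negPf sQ).
move: szp pth lst; case/splitPr: zp => p1 p2.
rewrite size_cat /= cat_path last_cat /= => szp /and3P[_ _ pth] lst.
have [|k' [k'p k's k't]] := IH z p2 _ pth lst.
  by move: szp; rewrite ltnS addnS; apply/leq_ltn_trans/leq_addl.
exists k'; split=> // [|t tS /(tz t tS)]; last exact: k't.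
by rewrite inE mem_cat k'p !orbT.
Qed.

(** Take a vertex of the component with the most neighbours in [S]. If it missed some [s], a path
    inside the component to a neighbour of [s] would contain a vertex with strictly more. *)
Lemma dominating_vertex (T : finType) (e : rel T) (S : {set T}) (u : T) :
  symmetric e ->
  (forall x y, ~~ e x y -> exists2 Q, complete e Q & separated e Q x y) ->
  complete e S -> u \notin S ->
  (forall s, s \in S -> exists2 k, k \in component e S u & e k s) ->
  exists2 k, k \in component e S u & forall s, s \in S -> e k s.
Proof.
move=> e_sym sepQ Scl uS nbr.
have uK : u \in component e S u by rewrite inE.
case: (arg_maxnP (fun k => #|[set s in S | e k s]|) uK) => k k_in kmax.
have kK : k \in component e S u by exact: k_in.
exists k => // s sS; apply: contraT => nks.
have [k1 k1K k1s] := nbr s sS.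
have /connectP[p pth k1p] := component_connect e_sym kK k1K.
have pthe : path e k p by apply: sub_path pth => x y /and3P[].
rewrite k1p in k1s.
have [k' [k'p k's k't]] :=
  dominating_vertex_on_path e_sym sepQ Scl sS pthe k1s.
have k'K : k' \in component e S u.
  move: kK; rewrite !inE => uk; apply: connect_trans uk _.
  exact: (path_connect pth).
have := kmax k' k'K; rewrite /= leqNgt => /negP[].
apply/proper_card/properP; split.
  by apply/subsetP => t; rewrite !inE => /andP[tS /(k't t tS)->]; rewrite tS.
by exists s; rewrite inE ?sS ?k's ?(negPf nks).
Qed.

(** * Chordal graphs, induced paths and complete separators *)

Lemma next_consecutive (T : eqType) (p q : seq T) (x y : T) :
  uniq (p ++ x :: y :: q) -> next (p ++ x :: y :: q) x = y.
Proof.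
move=> Uc; rewrite -(next_rot (size p)) // rot_size_cat /=.
by rewrite eqxx.
Qed.

(** If [x0] and [x2] are not adjacent, a complete [Q] separates them, so it meets both arcs between
    them: one in [x1], the other in some [y]. Completeness makes [x1] and [y] a chord. *)
Lemma chordal_of_complete_separators (m : nat) (g e : rel 'I_m) :
  (forall x y, g x y = (x != y) && e x y) -> symmetric e ->
  (forall x y, ~~ e x y -> exists2 Q, complete e Q & separated e Q x y) ->
  chordal g.
Proof.
move=> ge e_sym sepQ [|x0 [|x1 [|x2 [|x3 r]]]] // /andP[cyc Uc] _.
have Uc' := Uc.
move: Uc; rewrite /= !inE !negb_or => /and5P[/and4P[x01 x02 x03 x0r]].
move=> /and3P[x12 x13 x1r] /andP[x23 x2r] x3r Ur.
have nx0 : next [:: x0, x1, x2, x3 & r] x0 = x1 by rewrite /= eqxx.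
have nx1 := @next_consecutive _ [:: x0] (x3 :: r) x1 x2 Uc'.
have nx2 := @next_consecutive _ [:: x0; x1] r x2 x3 Uc'.
rewrite /= in nx1 nx2.
have [e02|n02] := boolP (e x0 x2).
  exists x0, x2; split; rewrite ?nx0 ?nx2 ?ge ?x02 ?inE ?eqxx ?orbT //.
  by rewrite eq_sym.
have [Q Qcl Qsep] := sepQ _ _ n02.
have [x0Q x2Q] : x0 \notin Q /\ x2 \notin Q by case/and3P: Qsep.
have epath : path e x0 (rcons [:: x1, x2, x3 & r] x0).
  by apply: sub_path cyc => x y; rewrite ge => /andP[].
move: epath; rewrite /= => /and4P[e01 e12 e23 ep].
have x1Q : x1 \in Q.
  have [|z] := @separated_path _ e Q x0 [:: x1; x2] _ Qsep.
    by rewrite /= e01 e12.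
  by rewrite !inE => /orP[] /eqP-> //; rewrite (negPf x2Q).
have [||y] := @separated_path _ e Q x2 (rcons (x3 :: r) x0) _ _.
- by rewrite /= e23.
- by rewrite last_rcons separated_sym.
rewrite mem_rcons inE => /orP[/eqP->|yr yQ]; first by rewrite (negPf x0Q).
have yU : [/\ x0 != y, x1 != y & x2 != y].
  move: yr; rewrite inE => /orP[/eqP-> //|yr].
  by split; apply: contraTneq yr => <-.
case: yU => x0y x1y x2y.
exists x1, y; split; rewrite ?nx1 ?ge ?x1y ?Qcl //.
- by rewrite !inE eqxx orbT.
- by move: yr; rewrite !inE => ->; rewrite !orbT.
- by rewrite eq_sym.
(* On the cycle [x1] is the successor of [x0] only. *)
apply: contraNneq x0y => x1n.
have := congr1 (prev [:: x0, x1, x2, x3 & r]) (etrans nx0 x1n).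
by rewrite !prev_next // => ->.
Qed.

(** The last clause says that the path is induced. A path of minimal length has this property, since
    an edge from [x] to [y] would bypass [p2]. *)
Lemma shortest_path (T : finType) (e : rel T) (A : {pred T}) (s : T) (p : seq T) :
  path e s p -> {subset p <= A} ->
  exists w, [/\ path e s w, last s w = last s p, {subset w <= A}, uniq (s :: w)
    & forall p1 x p2 y p3, s :: w = p1 ++ x :: p2 ++ y :: p3 -> e x y -> p2 = [::]].
Proof.
move: {2 3}(last s p) (erefl (last s p)) => t lp pth pA.
pose good w := [&& path e s w, last s w == t, all A w & uniq (s :: w)].
have [w0 gw0] : exists w, good w.
  case/shortenP: pth pA lp => w pw Uw wp pA lw.
  exists w; rewrite /good pw Uw lw eqxx /= andbT.
  by apply/allP => x /wp/pA.
have exn : exists n, [exists w : n.-tuple T, good w].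
  by exists (size w0); apply/existsP; exists (in_tuple w0).
case: (ex_minnP exn) => n /existsP[w /and4P[pw /eqP lw /allP wA Uw]] wmin.
exists w; split=> // p1 x p2 y p3 dw xy.
suff: exists2 w', good w' & (size p1 + size p3).+2 = (size w').+1.
  move=> [w' gw' sz].
  have /wmin : [exists v : (size w').-tuple T, good v].
    by apply/existsP; exists (in_tuple w').
  rewrite -ltnS -sz -(size_tuple w) -[(size w).+1]/(size (s :: w)) dw.
  rewrite size_cat /= size_cat /= !addnS !ltnS leq_add2l.
  by rewrite -[leqRHS]add0n leq_add2r leqn0 size_eq0 => /eqP.
(* The start [s] is not part of the tail [w], so a bypass that begins at [s] is treated apart. *)
case: p1 dw => [|s1 p1] [eqs dw].
- exists (y :: p3) => //; rewrite -eqs in xy.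
  have sub : subseq (y :: p3) w by rewrite dw suffix_subseq.
  move: pw lw; rewrite dw cat_path last_cat => /andP[_ /=/andP[_ pp]] ll.
  apply/and4P; split; [by rewrite /= xy | exact/eqP | |].
    by apply/allP => z /(mem_subseq sub) /wA.
  by apply: subseq_uniq Uw; rewrite [subseq _ _]/= eqxx.
- exists (p1 ++ x :: y :: p3); last by rewrite size_cat /= !addnS.
  have sub : subseq (p1 ++ x :: y :: p3) w.
    rewrite dw; apply: cat_subseq => //; rewrite /= eqxx.
    exact: suffix_subseq.
  move: pw lw; rewrite dw cat_path last_cat /= cat_path last_cat /=.
  move=> /and4P[pp1 px _ /andP[_ pp]] ll.
  apply/and4P; split.
  - by rewrite cat_path /= pp1 px xy.
  - by rewrite last_cat; apply/eqP.
  - by apply/allP => z /(mem_subseq sub) /wA.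
  - by apply: subseq_uniq Uw; rewrite [subseq _ _]/= eqxx.
Qed.

Lemma component_path (T : finType) (e : rel T) (S : {set T}) (u s t : T) :
  symmetric e -> ~~ e s t -> s != t -> s \in S -> t \in S -> u \notin S ->
  (exists2 k, k \in component e S u & e k s) ->
  (exists2 k, k \in component e S u & e k t) ->
  exists p, [/\ p != [::], {subset p <= component e S u}, path e s (rcons p t),
    uniq (s :: rcons p t)
    & forall p1 x p2 y p3, s :: rcons p t = p1 ++ x :: p2 ++ y :: p3 ->
        e x y -> p2 = [::]].
Proof.
move=> e_sym nst st sS tS uS [k kK ks] [k' k'K k't].
have /connectP[q pq k'q] := component_connect e_sym kK k'K.
have qK : {subset q <= component e S u}.
  move=> x xq; move: (kK); rewrite !inE => uk; apply: connect_trans uk _.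
  by apply: (path_connect pq); rewrite inE xq orbT.
have pth : path e s (k :: rcons q t).
  rewrite /= e_sym ks rcons_path -k'q k't andbT.
  by apply: sub_path pq => x y /and3P[].
(* Only the tail of the path is confined to [A], which must admit the endpoint [t]; uniqueness later
   keeps [t] out of the interior. *)
pose A := [pred x | (x == t) || (x \in component e S u)].
have sub : {subset k :: rcons q t <= A}.
  move=> x; rewrite inE mem_rcons inE /A inE => /or3P[/eqP->|->|/qK->] //;
  by rewrite ?kK orbT.
have [w [pw lw wA Uw short]] := shortest_path pth sub.
rewrite /= last_rcons in lw.
case/lastP: w pw lw wA Uw short => [|p z] pw lw wA Uw short.
  by rewrite /= in lw; rewrite lw eqxx in st.
rewrite last_rcons in lw; rewrite {z}lw in pw wA Uw short.
exists p; split=> //.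
  by apply: contraNneq nst => p0; move: pw; rewrite p0 /= andbT.
move=> x xp; have := wA x; rewrite mem_rcons inE xp orbT => /(_ isT).
rewrite inE => /orP[/eqP xt|//].
by move: Uw; rewrite /= rcons_uniq -xt xp andbF.
Qed.

Lemma path_uniq_irrefl (T : eqType) (e g : rel T) (s : T) (p : seq T) :
  (forall x y, g x y = (x != y) && e x y) ->
  uniq (s :: p) -> path e s p -> path g s p.
Proof.
move=> ge; elim: p s => //= x p IH s /andP[]; rewrite inE negb_or => /andP[sx _].
by move=> Up /andP[sxe pp]; rewrite ge sx sxe IH.
Qed.

(** Shows that a chord of a cycle cannot have both ends on an induced arc [l]; the two alternatives
    are the two orders of [x] and [y] on [l]. *)
Lemma chordless_consecutive (T : eqType) (e : rel T) (l r : seq T) (x y : T) :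
  symmetric e ->
  (forall p1 a p2 b p3, l = p1 ++ a :: p2 ++ b :: p3 -> e a b -> p2 = [::]) ->
  uniq (l ++ r) -> x \in l -> y \in l -> x != y -> e x y ->
  next (l ++ r) x = y \/ next (l ++ r) y = x.
Proof.
move=> e_sym short U xl yl xy exy.
have [p1 [p2 dl]] : exists p1 p2, l = p1 ++ x :: p2.
  by case/splitPr: xl => p1 p2; exists p1, p2.
move: (yl); rewrite dl mem_cat inE eq_sym (negPf xy) /= => /orP[] yp.
  case/splitPr: yp dl => q1 q2; rewrite -catA /= => dl.
  have q0 := short _ _ _ _ _ dl; rewrite e_sym exy in q0.
  rewrite dl (q0 isT) /= -catA /= in U *.
  by right; apply: next_consecutive.
case/splitPr: yp dl => q1 q2 dl.
have q0 := short _ _ _ _ _ dl exy.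
rewrite dl q0 /= -catA /= in U *.
by left; apply: next_consecutive.
Qed.

(* If [s] and [t] in the separator were not adjacent, shortest [s]-[t] paths
   through the components of [u] and of [v] would form a chordless cycle. *)
Lemma chordal_minimal_separator_complete (m : nat) (g e : rel 'I_m)
    (S : {set 'I_m}) (u v : 'I_m) :
  (forall x y, g x y = (x != y) && e x y) -> reflexive e -> symmetric e ->
  chordal g -> separated e S u v ->
  (forall S' : {set 'I_m}, S' \proper S -> ~~ separated e S' u v) ->
  complete e S.
Proof.
move=> ge e_refl e_sym ch sep minS s t sS tS; apply: contraT => nst.
have st : s != t by apply: contraNneq nst => ->.
have sep' : separated e S v u by rewrite separated_sym.
have minS' (S' : {set 'I_m}) : S' \proper S -> ~~ separated e S' v u.
  by rewrite separated_sym //; apply: minS.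
have [uS vS] : u \notin S /\ v \notin S by case/and3P: sep.
have nts : ~~ e t s by rewrite e_sym.
have ts : t != s by rewrite eq_sym.
have [p [p0 pK pp Up shortp]] := component_path e_sym nst st sS tS uS
  (minimal_separator_neighbor sep minS sS) (minimal_separator_neighbor sep minS tS).
have [q [q0 qK pq Uq shortq]] := component_path e_sym nts ts tS sS vS
  (minimal_separator_neighbor sep' minS' tS)
  (minimal_separator_neighbor sep' minS' sS).
have pq_nadj x y : x \in p -> y \in q -> ~~ e x y.
  by move=> /pK xK /qK; apply: separated_components_nonadjacent xK.
have Uc : uniq ((s :: p) ++ (t :: q)).
  move: Up Uq; rewrite /= !rcons_uniq !mem_rcons !mem_cat !inE !negb_or cat_uniq.
  move=> /andP[/andP[-> ->] /andP[tp ->]] /andP[/andP[_ tq] /andP[-> Uq]].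
  rewrite /= tq Uq negb_or tp /= !andbT.
  apply/hasPn => x xq; apply/negP => xp.
  by case/negP: (pq_nadj x x xp xq).
set c := (s :: p) ++ (t :: q) in Uc.
have cyc : cycle g c.
  rewrite /c /= -cat_rcons rcons_cat cat_path last_rcons.
  by rewrite !(path_uniq_irrefl ge).
have szc : (3 < size c)%N.
  rewrite /c size_cat; case: (p) (q) p0 q0 => [|? ?] [|? ?] // _ _.
  exact: (@leq_add 2 2).
have [a [b [ac bc nab nba]]] : exists a b, [/\ a \in c, b \in c, b != next c a,
    a != next c b & g a b].
  by apply: ch => //; exact/andP.
rewrite ge => /andP[ab eab].
(* Each induced path, both ends included, is an arc of the cycle, the second one after a rotation;
   so neither can carry the whole chord. *)
have c1 : c = (s :: rcons p t) ++ q by rewrite /c /= cat_rcons.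
have c2 : rot (size (s :: p)) c = (t :: rcons q s) ++ p.
  by rewrite /c rot_size_cat /= cat_rcons.
have in1 : a \in s :: rcons p t -> b \in s :: rcons p t -> False.
  move=> a1 b1; rewrite c1 in Uc nab nba.
  have [n|n] := chordless_consecutive e_sym shortp Uc a1 b1 ab eab.
    by rewrite n eqxx in nab.
  by rewrite n eqxx in nba.
have in2 : a \in t :: rcons q s -> b \in t :: rcons q s -> False.
  move=> a1 b1; rewrite -(next_rot (size (s :: p)) Uc) c2 in nab.
  rewrite -(next_rot (size (s :: p)) Uc) c2 in nba.
  rewrite -(rot_uniq (size (s :: p))) c2 in Uc.
  have [n|n] := chordless_consecutive e_sym shortq Uc a1 b1 ab eab.
    by rewrite n eqxx in nab.
  by rewrite n eqxx in nba.
(* The ends of the chord lie on a common closed arc or in different interiors; the latter is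
   excluded by [pq_nadj]. *)
exfalso; move: in1 in2 ac bc; rewrite /c /= !(mem_rcons, inE, mem_cat).
have := pq_nadj a b; have := pq_nadj b a; rewrite [e b a]e_sym eab.
by do ![case: (_ == _) | case: (_ \in _)] => //= A B C D;
  do ?[have := A isT isT => // | have := B isT isT => //];
  do ?[by apply: C | by apply: D].
Qed.

Lemma separated_complement_pair (T : finType) (e : rel T) (u v : T) :
  u != v -> ~~ e u v -> separated e (~: [set u; v]) u v.
Proof.
move=> uv nuv; rewrite /separated !inE !eqxx orbT /=.
have /subsetP/(_ v) : component e (~: [set u; v]) u \subset [set u].
  apply: component_sub => [|x y]; rewrite !inE ?eqxx // => /eqP->.
  move=> /and3P[uy _]; rewrite !inE negbK => /orP[] // /eqP yv.
  by rewrite yv (negPf nuv) in uy.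
by rewrite !inE eq_sym (negPf uv) => H; apply/negP => /H.
Qed.

Lemma exists_minimal_separator (T : finType) (e : rel T) (u v : T) :
  u != v -> ~~ e u v -> exists S, separated e S u v /\
    (forall S' : {set T}, S' \proper S -> ~~ separated e S' u v).
Proof.
move=> uv nuv.
have [S /minsetP[sepS minS] _] :=
  minset_exists (P := fun S => separated e S u v) (separated_complement_pair uv nuv).
exists S; split=> // S' /andP[S'S nSS']; apply: contraNN nSS' => sep'.
by rewrite (minS S' sep' S'S).
Qed.

(** * Decompositions of hypergraphs *)

Lemma tripartition_separated (m : nat)
    (e : rel 'I_m) (A B S : {set 'I_m}) (u v : 'I_m) :
  tripartition A B S -> u \in A -> v \in B ->
  (forall x y, x \in A -> y \in B -> ~~ e x y) -> separated e S u v.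
Proof.
move=> /and4P[/eqP ABS AB AS BS] uA vB noedge.
rewrite /separated (disjointFr AS uA) (disjointFr BS vB) /=.
have /subsetP sub : component e S u \subset A.
  apply: component_sub => // x y xA /and3P[xy _ yS].
  have := in_setT y; rewrite -ABS !inE (negPf yS) orbF => /orP[] // yB.
  by rewrite (negPf (noedge _ _ xA yB)) in xy.
by apply/negP => /sub vA; rewrite (disjointFr AB vA) in vB.
Qed.

(** The two sides are the component of [u] and everything else outside [S]. *)
Lemma separated_hg_decomposition (m : nat) (H : {set {set 'I_m}})
    (S : {set 'I_m}) (u v : 'I_m) :
  separated (adjacent H) S u v ->
  exists A B, [/\ hg_decomposition H A B S, u \in A & v \in B].
Proof.
move=> /and3P[uS vS uv]; set A := component (adjacent H) S u in uv.
have uA : u \in A by rewrite inE.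
have AS := component_notin (adjacent H) uS.
exists A, (~: (A :|: S)).
have vB : v \in ~: (A :|: S) by rewrite in_setC in_setU negb_or uv.
split=> //; apply/and4P; split.
- apply/and4P; split.
  + by apply/eqP/setP => x; rewrite !in_setU in_setC in_setU in_setT;
      case: (x \in A) (x \in S) => [] [].
  + by rewrite -setI_eq0 setCU setIA setICr set0I.
  + by rewrite disjoints_subset.
  + by rewrite disjoints_subset setCS subsetUr.
- by apply/set0Pn; exists u.
- by apply/set0Pn; exists v.
- apply/forall_inP => x xA; apply/forall_inP => y.
  rewrite in_setC in_setU negb_or => /andP[yA yS]; apply: contra yA => xy.
  exact: component_step xA xy yS.
Qed.

Lemma adjacent_sym (m : nat) (H : {set {set 'I_m}}) : symmetric (adjacent H).
Proof.
by move=> x y; apply: eq_existsb => E; congr (_ && _); rewrite andbC.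
Qed.

(** The disconnectedness asked for in [separator] is automatic: a walk in the induced subhypergraph
    is a walk in the adjacency graph avoiding [S]. This makes the graph lemmas applicable. *)
Lemma separatesE (m : nat) (H : {set {set 'I_m}}) (S : {set 'I_m}) (u v : 'I_m) :
  separates H S u v = partial_edge H S && separated (adjacent H) S u v.
Proof.
apply/idP/idP.
- case/andP=> /andP[-> _] /existsP[A /existsP[B /and3P[/and4P[tri _ _ nadj] uA vB]]].
  apply: (tripartition_separated tri uA vB) => x y xA yB.
  by move/forall_inP/(_ x xA)/forall_inP/(_ y yB): nadj.
- case/andP=> pe sep; rewrite /separates /separator pe /=; apply/andP; split.
    have /and3P[uS vS uv] := sep.
    apply/exists_inP; exists u; first by rewrite inE.
    apply/exists_inP; exists v; first by rewrite inE.
    apply: contra uv; rewrite inE; apply: connect_sub => x y.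
    case/exists_inP=> _ /imsetP[E EH ->]; rewrite !inE => /andP[/andP[xE xS] /andP[yE yS]].
    apply: connect1; apply/and3P; split=> //.
    by apply/exists_inP; exists E => //; rewrite xE.
  have [A [B [dec uA vB]]] := separated_hg_decomposition sep.
  by apply/existsP; exists A; apply/existsP; exists B; rewrite dec uA.
Qed.

Lemma partial_edge_sub (m : nat) (H : {set {set 'I_m}}) (S T : {set 'I_m}) :
  S \subset T -> partial_edge H T -> partial_edge H S.
Proof.
move=> ST /exists_inP[E EH TE]; apply/exists_inP; exists E => //.
exact: fintype.subset_trans ST TE.
Qed.

(** Subsets of a partial edge are partial edges, so minimality among partial edge separators is
    plain minimality in the adjacency graph. *)
Lemma dividerP (m : nat) (H : {set {set 'I_m}}) (S : {set 'I_m}) :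
  reflect (partial_edge H S /\ exists u v, separated (adjacent H) S u v /\
    forall S' : {set 'I_m}, S' \proper S -> ~~ separated (adjacent H) S' u v)
    (divider H S).
Proof.
apply: (iffP andP) => [[/andP[pe _] /existsP[u /existsP[v /andP[]]]]|[pe [u [v [sep minS]]]]].
  rewrite separatesE pe /= => sep /forallP minS; split=> //; exists u, v; split=> // S' S'S.
  have := minS S'; rewrite S'S separatesE /=.
  by rewrite (partial_edge_sub (proper_sub S'S) pe).
have sepS : separates H S u v by rewrite separatesE pe.
split; first by case/andP: sepS.
apply/existsP; exists u; apply/existsP; exists v; rewrite sepS /=.
apply/forall_inP => S' S'S; rewrite separatesE negb_and orbC.
by rewrite minS.
Qed.

(** * Hypergraphs of maximal cliques *)

Lemma clique_max_clique (m : nat) (g : rel 'I_m) (K : {set 'I_m}) :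
  clique g K -> exists2 M, M \in max_cliques g & K \subset M.
Proof. by move=> /maxset_exists[M maxM KM]; exists M; rewrite ?inE. Qed.

Lemma partial_edge_max_cliques (m : nat) (g : rel 'I_m) (K : {set 'I_m}) :
  partial_edge (max_cliques g) K = clique g K.
Proof.
apply/exists_inP/idP => [[M]|/clique_max_clique[M MH KM]]; last by exists M.
rewrite inE => /maxsetP[/forall_inP Mcl _] /subsetP KM.
apply/forall_inP => x /KM/Mcl/forall_inP xM; apply/forall_inP => y /KM.
exact: xM.
Qed.

Lemma cliqueP (m : nat) (g e : rel 'I_m) (K : {set 'I_m}) :
  (forall x y, g x y = (x != y) && e x y) -> reflexive e ->
  reflect (complete e K) (clique g K).
Proof.
move=> ge e_refl; apply: (iffP forall_inP) => [cl x y xK yK|cl x xK].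
  have := forall_inP (cl x xK) y yK; rewrite ge.
  by case: eqVneq => [->|_ /= ->].
apply/forall_inP => y yK; apply/implyP => xy; rewrite ge xy.
exact: cl.
Qed.

Lemma adjacent_max_cliques (m : nat) (g : rel 'I_m) (x y : 'I_m) :
  symmetric g -> adjacent (max_cliques g) x y = (x == y) || g x y.
Proof.
move=> g_sym; transitivity (clique g [set x; y]).
  rewrite -partial_edge_max_cliques; apply: eq_existsb => E.
  by rewrite subUset !sub1set.
apply/idP/idP => [/forall_inP/(_ x)|xy].
  rewrite !inE eqxx => /(_ isT)/forall_inP/(_ y).
  by rewrite !inE eqxx orbT implyNb; apply.
apply/forall_inP => a; rewrite !inE => /orP[] /eqP->;
  apply/forall_inP => b; rewrite !inE => /orP[] /eqP->;
  by rewrite ?eqxx // implyNb // eq_sym g_sym.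
Qed.

(** * Restriction of functions and tightness *)

Definition freeze (m : nat) (I : 'I_m -> nat) (b : cell I) (C : {set 'I_m})
    (x : cell I) : cell I :=
  [ffun j => if j \in C then x j else b j].

Definition restrict (R : realType) (m : nat) (I : 'I_m -> nat) (b : cell I)
    (C : {set 'I_m}) (f : tspace R I) : tspace R I :=
  [ffun x => f (freeze b C x)].

Lemma restrict_comp (R : realType) (m : nat) (I : 'I_m -> nat) (b : cell I)
    (C D : {set 'I_m}) (f : tspace R I) :
  restrict b C (restrict b D f) = restrict b (C :&: D) f.
Proof.
apply/ffunP => x; rewrite !ffunE; congr (f _); apply/ffunP => j.
by rewrite !ffunE inE; case: (j \in C); case: (j \in D).
Qed.

Lemma restrictD (R : realType) (m : nat) (I : 'I_m -> nat) (b : cell I)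
    (C : {set 'I_m}) (f g : tspace R I) :
  restrict b C (f + g) = restrict b C f + restrict b C g.
Proof. by apply/ffunP => x; rewrite !ffunE. Qed.

Lemma restrictB (R : realType) (m : nat) (I : 'I_m -> nat) (b : cell I)
    (C : {set 'I_m}) (f g : tspace R I) :
  restrict b C (f - g) = restrict b C f - restrict b C g.
Proof. by apply/ffunP => x; rewrite !ffunE. Qed.

Lemma restrict_Fsp (R : realType) (m : nat) (I : 'I_m -> nat) (b : cell I)
    (C : {set 'I_m}) (f : tspace R I) : restrict b C f \in Fsp R I C.
Proof.
apply/mem_Fsp => x y xy; rewrite !ffunE; congr (f _); apply/ffunP => j.
by rewrite !ffunE; case: ifP => // /xy.
Qed.

Lemma restrict_id (R : realType) (m : nat) (I : 'I_m -> nat) (b : cell I)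
    (C : {set 'I_m}) (f : tspace R I) : f \in Fsp R I C -> restrict b C f = f.
Proof.
move=> /mem_Fsp fC; apply/ffunP => x; rewrite ffunE; apply: fC => j jC.
by rewrite ffunE jC.
Qed.

Lemma Fsp_sub (R : realType) (m : nat) (I : 'I_m -> nat) (C D : {set 'I_m}) :
  C \subset D -> (Fsp R I C <= Fsp R I D)%VS.
Proof.
move=> /subsetP CD; apply/subvP => f /mem_Fsp fC; apply/mem_Fsp => x y xy.
by apply: fC => j /CD/xy.
Qed.

Lemma conformal2P (R : realType) (m : nat) (I : 'I_m -> nat)
    (L W1 W2 : {vspace tspace R I}) :
  reflect (L <= L :&: W1 + L :&: W2)%VS (conformal L [:: W1; W2]).
Proof.
rewrite /conformal big_cons big_seq1 eqEsubv subv_add !capvSl !andbT.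
exact: idP.
Qed.

(** Write f = g + h along the decomposition. The two vertex sets meet in [S], so restricting to the
    first turns f into g + h|S, to the second into g|S + h; saturation puts g|S and h|S in [L]. *)
Lemma sp_decomposition_restrict (R : realType) (m : nat) (I : 'I_m -> nat)
    (L : {vspace tspace R I}) (A1 A2 S : {set 'I_m}) (b : cell I)
    (f : tspace R I) :
  sp_decomposition L A1 A2 S -> f \in L ->
  [/\ restrict b (A1 :|: S) f \in L, restrict b (A2 :|: S) f \in L
    & f = restrict b (A1 :|: S) f + restrict b (A2 :|: S) f - restrict b S f].
Proof.
case/and5P=> /and4P[_ A12 _ _] _ _ _ /andP[/subvP sat /conformal2P/subvP con] fL.
have CD : (A1 :|: S) :&: (A2 :|: S) = S.
  by rewrite -setUIl (disjoint_setI0 A12) set0U.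
have [g gL [h hL ->]] := memv_addP (con f fL).
move: gL hL; rewrite !memv_cap => /andP[gL gC] /andP[hL hD].
have gD : restrict b (A2 :|: S) g = restrict b S g.
  by rewrite -{1}(restrict_id b gC) restrict_comp setIC CD.
have hC : restrict b (A1 :|: S) h = restrict b S h.
  by rewrite -{1}(restrict_id b hD) restrict_comp CD.
have inL k : restrict b S k \in L by apply/sat/restrict_Fsp.
rewrite !restrictD gD hC (restrict_id b gC) (restrict_id b hD).
split; rewrite ?memvD //.
by rewrite [restrict b S g + h]addrC addrACA [restrict b S h + _]addrC addrK.
Qed.

Lemma sp_decomposition_sym (R : realType) (m : nat) (I : 'I_m -> nat)
    (L : {vspace tspace R I}) (A1 A2 S : {set 'I_m}) :
  sp_decomposition L A1 A2 S -> sp_decomposition L A2 A1 S.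
Proof.
case/and5P=> /and4P[ABS AB AS BS] nA nB nS /andP[sat con].
apply/and5P; split=> //; last (apply/andP; split=> //).
  by rewrite /tripartition (setUC A2) (disjoint_sym A2 A1) ABS AB BS AS.
by move: con; rewrite /conformal !big_cons !big_nil !addv0 addvC.
Qed.

Lemma tight_sym (R : realType) (m : nat) (I : 'I_m -> nat)
    (L : {vspace tspace R I}) : symmetric (tight L).
Proof.
suff H u v : tight L u v -> tight L v u by move=> u v; apply/idP/idP; apply: H.
apply: contra => /existsP[A [/existsP[B /existsP[S /and3P[dec vA uB]]]]].
apply/existsP; exists B; apply/existsP; exists A; apply/existsP; exists S.
by rewrite sp_decomposition_sym // uB.
Qed.

Lemma tight_refl (R : realType) (m : nat) (I : 'I_m -> nat)
    (L : {vspace tspace R I}) : reflexive (tight L).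
Proof.
move=> u; apply/negP.
case/existsP=> A /existsP[B /existsP[S /and3P[/and5P[/and4P[_ AB _ _] _ _ _ _] uA]]].
by rewrite (disjointFr AB uA).
Qed.

Lemma nontightP (R : realType) (m : nat) (I : 'I_m -> nat)
    (L : {vspace tspace R I}) (u v : 'I_m) :
  reflect (exists A1 A2 S, [/\ sp_decomposition L A1 A2 S, u \in A1 & v \in A2])
    (~~ tight L u v).
Proof.
rewrite negbK; apply: (iffP existsP).
  by case=> A /existsP[B /existsP[S /and3P[]]]; exists A, B, S.
case=> A [B [S [dec uA vB]]]; exists A; apply/existsP; exists B.
by apply/existsP; exists S; rewrite dec uA.
Qed.

(* The interaction of two coordinates separated by a decomposition cannot lie
   in [L]: it vanishes as soon as either coordinate is frozen. *)
Lemma saturated_tight (R : realType) (m : nat) (I : 'I_m -> nat)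
    (L : {vspace tspace R I}) (S : {set 'I_m}) :
  (forall j, 2 <= I j)%N -> saturated L S -> complete (tight L) S.
Proof.
move=> hI /subvP sat s t sS tS; apply: contraT.
case/nontightP=> A1 [A2 [T [dec sA1 tA2]]].
(* The cells with all levels 0 and all levels 1. *)
pose b : cell I := [ffun j => Ordinal (ltnW (hI j))].
pose x : cell I := [ffun j => Ordinal (hI j)].
have xb j : x j != b j by rewrite !ffunE.
pose f : tspace R I := [ffun y : cell I => ((y s != b s) && (y t != b t))%:R].
have fL : f \in L.
  by apply/sat/mem_Fsp => y z yz; rewrite !ffunE !yz.
have /and5P[/and4P[_ A12 A1T A2T] _ _ _ _] := dec.
have [sT tT] : s \notin T /\ t \notin T.
  by rewrite (disjointFr A1T sA1) (disjointFr A2T tA2).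
have [sA2 tA1] : s \notin A2 /\ t \notin A1.
  by rewrite (disjointFr A12 sA1) (disjointFl A12 tA2).
(* At [x] the value of [f] is 1, while each of the three restrictions freezes [s] or [t] and gives
   0. *)
have [_ _ /ffunP/(_ x)] := sp_decomposition_restrict b dec fL.
rewrite !ffunE !inE.
rewrite (negPf sT) (negPf tT) (negPf sA2) (negPf tA1) !eqxx /= !andbF !addr0 subr0.
by move/eqP; rewrite oner_eq0.
Qed.

(** The separator of a decomposition is saturated, hence complete, and no pair across it is tight.
    This supplies the separation hypothesis of the graph lemmas for [tight L]. *)
Lemma nontight_separated (R : realType) (m : nat) (I : 'I_m -> nat)
    (L : {vspace tspace R I}) (u v : 'I_m) :
  (forall j, 2 <= I j)%N -> ~~ tight L u v ->
  exists2 Q, complete (tight L) Q & separated (tight L) Q u v.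
Proof.
move=> hI /nontightP[A1 [A2 [S [dec uA1 vA2]]]]; exists S.
  by case/and5P: dec => _ _ _ _ /andP[sat _]; apply: saturated_tight.
have /andP[tri _] := dec.
apply: (tripartition_separated tri uA1 vA2) => x y xA1 yA2.
by apply/nontightP; exists A1, A2, S.
Qed.

(** Induction on the size of [E]. A non-tight pair in [E] gives a decomposition; each of the three
    pieces of [E] misses [u] or [v], hence is smaller, and restriction to it still preserves [L]. *)
Lemma restrict_mem_sum_complete (R : realType) (m : nat) (I : 'I_m -> nat)
    (L : {vspace tspace R I}) (M : {set {set 'I_m}}) (b : cell I)
    (E : {set 'I_m}) :
  (forall K : {set 'I_m}, complete (tight L) K -> exists2 C, C \in M & K \subset C) ->
  (forall f, f \in L -> restrict b E f \in L) ->
  forall f, f \in L -> restrict b E f \in (\sum_(C in M) (L :&: Fsp R I C))%VS.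
Proof.
move=> cover; have [n] := ubnP #|E|; elim: n E => // n IH E szE EL f fL.
have [/forall_inP cl|] := boolP (ext_compact L E).
  have [|C CM EC] := cover E.
    by move=> u v uE vE; apply: (forall_inP (cl u uE)).
  apply: (subvP (sumv_sup C CM (subvv _))).
  by rewrite memv_cap EL //= (subvP (Fsp_sub _ _ EC)) ?restrict_Fsp.
case/forall_inPn=> u uE /forall_inPn[v vE /nontightP[A1 [A2 [S [dec uA1 vA2]]]]].
have /and5P[/and4P[_ A12 A1T A2T] _ _ _ /andP[/subvP sat _]] := dec.
have key D : (forall h, h \in L -> restrict b D h \in L) ->
    (u \notin D) || (v \notin D) ->
    restrict b (E :&: D) f \in (\sum_(C in M) (L :&: Fsp R I C))%VS.
  move=> DL uvD; apply: IH => // [|h hL]; last first.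
    by rewrite -restrict_comp; apply/EL/DL.
  move: szE; rewrite ltnS; apply: leq_trans; apply/proper_card/properP.
  split; first exact: subsetIl.
  by case/orP: uvD => [uD|vD]; [exists u | exists v];
    rewrite ?inE ?(negPf uD) ?(negPf vD) ?andbF.
have [_ _ ->] := sp_decomposition_restrict b dec fL.
rewrite restrictB restrictD !restrict_comp memvB ?memvD ?key //.
- by move=> h /(sp_decomposition_restrict b dec)[].
- by rewrite !inE (disjointFl A12 vA2) (disjointFr A2T vA2) orbT.
- by move=> h /(sp_decomposition_restrict b dec)[].
- by rewrite !inE (disjointFr A12 uA1) (disjointFr A1T uA1).
- by move=> h _; apply/sat/restrict_Fsp.
- by rewrite (disjointFr A1T uA1).
Qed.

(** * Hierarchical subspace models *)

Lemma conformal_enumE (R : realType) (m : nat) (I : 'I_m -> nat)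
    (L : {vspace tspace R I}) (M : {set {set 'I_m}}) :
  conformal L [seq Fsp R I C | C <- enum M] =
    (L <= \sum_(C in M) (L :&: Fsp R I C))%VS.
Proof.
rewrite /conformal big_map big_enum /= eqEsubv.
suff -> : (\sum_(C in M) (L :&: Fsp R I C) <= L)%VS by rewrite andbT.
by apply/subv_sumP => C _; apply: capvSl.
Qed.

Lemma complete_hg_compact (m : nat) (H : {set {set 'I_m}}) (K : {set 'I_m}) :
  complete (adjacent H) K -> hg_compact H K.
Proof.
move=> cl; apply/forall_inP => u uK; apply/forall_inP => v vK.
apply/existsPn => S; rewrite separatesE negb_and; apply/orP; right.
apply/negP => sep.
have [|z] := @separated_path _ (adjacent H) S u [:: v] _ sep.
  by rewrite /= cl.
by rewrite inE => /eqP->; case/and3P: sep => _ /negPf->.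
Qed.

(* By the choice of [k] and [k'], any decomposition of [L] separating them has
   all of [S] in its separator. *)
Lemma minimal_separator_saturated (R : realType) (m : nat) (I : 'I_m -> nat)
    (L : {vspace tspace R I}) (S : {set 'I_m}) (u v : 'I_m) :
  (forall j, 2 <= I j)%N -> complete (tight L) S -> separated (tight L) S u v ->
  (forall S' : {set 'I_m}, S' \proper S -> ~~ separated (tight L) S' u v) ->
  saturated L S.
Proof.
move=> hI Scl sep minS; have t_sym := tight_sym L.
have sep' : separated (tight L) S v u by rewrite separated_sym.
have minS' (S' : {set 'I_m}) : S' \proper S -> ~~ separated (tight L) S' v u.
  by rewrite separated_sym //; apply: minS.
have [uS vS] : u \notin S /\ v \notin S by case/and3P: sep.
have sepQ x y := @nontight_separated R m I L x y hI.
have [k kK kS] := dominating_vertex t_sym sepQ Scl uS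
  (fun s => minimal_separator_neighbor sep minS).
have [k' k'K k'S] := dominating_vertex t_sym sepQ Scl vS
  (fun s => minimal_separator_neighbor sep' minS').
have /nontightP[A1 [A2 [T [dec kA1 k'A2]]]] :=
  separated_components_nonadjacent t_sym sep kK k'K.
have /and5P[/and4P[/eqP ABT _ _ _] _ _ _ /andP[sat _]] := dec.
(* As [T] is saturated, S in T suffices: an [s] in [A1] would not be tight with [k'], one in [A2]
   not with [k]. *)
apply: subv_trans sat; apply/Fsp_sub/subsetP => s sS.
have := in_setT s; rewrite -ABT !inE => /orP[/orP[] sA|//].
  have /nontightP/negPf : exists A1 A2 T,
    [/\ sp_decomposition L A1 A2 T, s \in A1 & k' \in A2] by exists A1, A2, T.
  by rewrite t_sym k'S.
have /nontightP/negPf : exists A1 A2 T,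
  [/\ sp_decomposition L A1 A2 T, k \in A1 & s \in A2] by exists A1, A2, T.
by rewrite kS.
Qed.

Lemma max_ext_compactE (R : realType) (m : nat) (I : 'I_m -> nat)
    (L : {vspace tspace R I}) :
  max_ext_compact L = max_cliques [rel x y | (x != y) && tight L x y].
Proof.
apply/setP => C; rewrite !inE; apply: maxset_eq => K.
apply/forall_inP/(cliqueP K (e := tight L) (fun x y => erefl) (@tight_refl _ _ _ L)).
- by move=> H x y xK yK; apply: (forall_inP (H x xK)).
- by move=> cl x xK; apply/forall_inP => y; apply: cl.
Qed.

Lemma adjacent_max_ext_compact (R : realType) (m : nat) (I : 'I_m -> nat)
    (L : {vspace tspace R I}) : adjacent (max_ext_compact L) =2 tight L.
Proof.
move=> x y; rewrite max_ext_compactE adjacent_max_cliques => [/=|a b /=].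
  by case: eqVneq => [->|//]; rewrite tight_refl.
by rewrite eq_sym tight_sym.
Qed.

(** Adjacency in this hypergraph is tightness, so its dividers are minimal separators of the
    tightness graph. Conformality comes from splitting, started at the full vertex set, where
    restriction is the identity. *)
Lemma HSM_max_ext_compact (R : realType) (m : nat) (I : 'I_m -> nat)
    (L : {vspace tspace R I}) :
  (forall j, 2 <= I j)%N -> HSM L (max_ext_compact L).
Proof.
move=> hI; have adjE := adjacent_max_ext_compact L.
have g_e x y : [rel x y | (x != y) && tight L x y] x y = (x != y) && tight L x y.
  by [].
have sepE S x y :
    separated (adjacent (max_ext_compact L)) S x y = separated (tight L) S x y.
  rewrite /separated /component !inE; congr [&& _, _ & ~~ _].
  by apply: eq_connect => a b; rewrite /avoiding /= adjE.
split=> [S /dividerP[pe [u [v [sep minS]]]]|].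
  rewrite max_ext_compactE partial_edge_max_cliques in pe.
  have Scl := cliqueP _ g_e (@tight_refl _ _ _ L) pe.
  rewrite sepE in sep; apply: minimal_separator_saturated hI Scl sep _ => S' S'S.
  by rewrite -sepE minS.
pose b : cell I := [ffun j => Ordinal (ltnW (hI j))].
have cover (K : {set 'I_m}) : complete (tight L) K ->
    exists2 C, C \in max_compact (max_ext_compact L) & K \subset C.
  move=> Kcl; have [|C maxC KC] := @maxset_exists _ (hg_compact (max_ext_compact L)) K.
    by apply: complete_hg_compact => x y xK yK; rewrite adjE Kcl.
  by exists C; rewrite // inE.
have restrT (f : tspace R I) : restrict b [set: 'I_m] f = f.
  by apply: restrict_id; apply/mem_Fsp => x y xy; congr (f _); apply/ffunP => j;
    rewrite xy.
rewrite conformal_enumE; apply/subvP => f fL.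
rewrite -(restrT f); apply: (restrict_mem_sum_complete cover) => // h hL.
by rewrite restrT.
Qed.

(** * Minimality among decomposable models *)

Lemma conformal_of_separated (R : realType) (m : nat) (I : 'I_m -> nat)
    (L : {vspace tspace R I}) (H : {set {set 'I_m}}) (A B S : {set 'I_m}) :
  partial_edge H S -> hg_decomposition H A B S ->
  conformal L [seq Fsp R I C | C <- enum (max_compact H)] ->
  conformal L [:: Fsp R I (A :|: S); Fsp R I (B :|: S)].
Proof.
move=> pe dec; rewrite conformal_enumE => con; apply/conformal2P.
have /and4P[tri _ _ /forall_inP nadj] := dec.
have /and4P[/eqP ABS _ _ _] := tri.
apply: subv_trans con _; apply/subv_sumP => C; rewrite inE => /maxsetP[/forall_inP Cc _].
(* A compact component cannot meet both [A] and [B], which the partial edge [S] separates. *)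
have [CA|/subsetPn[y yC]] := boolP (C \subset A :|: S).
  apply: subv_trans (addvSl _ _); apply: capvS => //; exact: Fsp_sub.
rewrite inE negb_or => /andP[yA yS].
have yB : y \in B by have := in_setT y; rewrite -ABS !inE (negPf yA) (negPf yS) orbF.
suff CB : C \subset B :|: S.
  apply: subv_trans (addvSr _ _); apply: capvS => //; exact: Fsp_sub.
apply/subsetP => x xC; have := in_setT x; rewrite -ABS !inE.
case/orP=> [/orP[xA|->]|->]; rewrite ?orbT //.
have /forall_inP/(_ y yC)/existsP[] := Cc x xC.
exists S; rewrite separatesE pe.
apply: (tripartition_separated tri xA yB) => a c aA cB.
exact: forall_inP (nadj a aA) c cB.
Qed.

Lemma tight_adjacent (R : realType) (m : nat) (I : 'I_m -> nat)
    (L : {vspace tspace R I}) (H : {set {set 'I_m}}) (u v : 'I_m) :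
  connected_sp L -> decomposable H -> HSM L H -> u != v -> tight L u v ->
  adjacent H u v.
Proof.
move=> Lconn [g [g_sym g_irr g_ch Hg]] [Hdiv Hcon] uv; apply: contraTT => nuv.
have adjE x y : adjacent H x y = (x == y) || g x y.
  by rewrite Hg adjacent_max_cliques.
have adj_refl : reflexive (adjacent H) by move=> x; rewrite adjE eqxx.
have g_e x y : g x y = (x != y) && adjacent H x y.
  by rewrite adjE; case: eqVneq => // ->; rewrite g_irr.
have [S [sep minS]] := exists_minimal_separator uv nuv.
have pe : partial_edge H S.
  rewrite Hg partial_edge_max_cliques; apply/(cliqueP _ g_e adj_refl).
  exact: chordal_minimal_separator_complete g_e adj_refl (adjacent_sym H) g_ch sep minS.
have sat : saturated L S.
  by apply: Hdiv; apply/dividerP; split=> //; exists u, v.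
have [A [B [dec uA vB]]] := separated_hg_decomposition sep.
have con := conformal_of_separated pe dec Hcon.
have /and4P[tri A0 B0 _] := dec.
(* A non-empty [S] yields a decomposition of [L]. An empty one makes [B] the complement of [A],
   against connectedness. *)
have [S0|S0] := eqVneq S set0; last first.
  apply/nontightP; exists A, B, S; split=> //.
  by apply/and5P; split=> //; apply/andP.
case: Lconn; exists A; move: tri con; rewrite /tripartition S0 !setU0.
case/and4P=> /eqP AB disAB _ _ con.
have BA : B = ~: A.
  apply/setP => x; rewrite inE; have := in_setT x; rewrite -AB inE.
  by case: (boolP (x \in A)) => [/(disjointFr disAB)->|_ /= ->].
split=> //; last by rewrite -BA.
by rewrite properT; apply: contraTneq B0 => AT; rewrite BA AT setCT eqxx.
Qed.

Theorem theorem2 (R : realType) (m : nat) (I : 'I_m -> nat)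
  (hI : forall j, (2 <= I j)%N)
  (L : {vspace tspace R I})
  (L1 : [ffun=> 1 : R^o] \in L)
  (Lconn : connected_sp L) :
  [/\ decomposable (max_ext_compact L),
      HSM L (max_ext_compact L)
    & forall Delta : {set {set 'I_m}},
        simplicial_complex Delta ->
        decomposable (red Delta) ->
        HSM L (red Delta) ->
        (logaffine (hsp R I (max_ext_compact L))
           `<=` logaffine (hsp R I (red Delta)))%classic].
Proof.
split.
- exists [rel x y | (x != y) && tight L x y]; split.
  + by move=> x y /=; rewrite eq_sym tight_sym.
  + by move=> x /=; rewrite eqxx.
  + apply: (@chordal_of_complete_separators _ _ (tight L)) => //.
      exact: tight_sym.
    by move=> x y; apply: nontight_separated.
  + exact: max_ext_compactE.
- exact: HSM_max_ext_compact.
(* Inclusion of the models follows from inclusion of the subspaces, checked on each summand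
   [F_C]. *)
move=> Delta _ dec hsm p [p_gt0 p_sum lnp]; split=> //; apply: subvP lnp.
apply/subv_sumP => C; rewrite inE => /maxsetP[/forall_inP Ccl _].
have [g [g_sym _ _ redE]] := dec.
(* Tight vertices are adjacent in [red Delta], so [C] lies in one of its facets. *)
have /clique_max_clique[K Kmax CK] : clique g C.
  apply/forall_inP => u uC; apply/forall_inP => v vC; apply/implyP => uv.
  have := tight_adjacent Lconn dec hsm uv (forall_inP (Ccl u uC) v vC).
  by rewrite redE adjacent_max_cliques // (negPf uv).
rewrite -redE in Kmax.
by apply: subv_trans (Fsp_sub R I CK) (sumv_sup K Kmax (subvv _)).
Qed.
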